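(* Every sequence of graphs $G_1,G_2,\dots$ with $e(G_j)\ge1$ for all $j$ and satisfying $\ell(G_j)=O(\sqrt{e(G_j)})$ is subsequentially sampling convergent, i.e. has a subsequence that is sampling convergent.
   Context: Graphs are finite, without multiple edges, but may have loops; $e(G)$ is the number of non-loop edges and $\ell(G)$ the number of loops of $G$. An unlabeled graph is an isomorphism class of graphs; the set of finite unlabeled graphs is countable and discrete. $p$-sampling: $\mathsf{Smpl}(G,p)$ is the random unlabeled graph obtained by keeping each vertex of $G$ independently with probability $\min(p,1)$, taking the induced subgraph, discarding its isolated vertices (vertices contained in no edge, loop or non-loop), and forgetting labels. $\mathrm{SmplD}(G,s)$ is the probability distribution of $\mathsf{Smpl}(G,s/\sqrt{2e(G)})$. A sequence $G_1,G_2,\dots$ is sampling convergent if for every $s\in\mathbb R_+$ the distributions $\mathrm{SmplD}(G_j,s)$ converge weakly as $j\to\infty$ (to a probability distribution on finite unlabeled graphs). *)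

(* Defs.v *)
From HB Require Import structures.
From mathcomp Require Import all_boot all_order all_algebra.
From mathcomp Require Import generic_quotient.
From mathcomp Require Import all_classical all_reals all_analysis.
Import Order.TTheory GRing.Theory Num.Theory.
Import numFieldNormedType.Exports.

Set Implicit Arguments.
Unset Strict Implicit.
Unset Printing Implicit Defensive.

Local Open Scope classical_set_scope.
Local Open Scope ring_scope.

Record graph := Graph {
  vertex :> finType;
  adj : rel vertex;
  adj_sym : symmetric adj
}.

Definition edges (G : graph) : {set {set G}} :=
  finset (fun E : {set G} =>
    [exists x : G, exists y : G, [&& x != y, adj x y & E == [set x; y]%SET]]).

Definition nedges (G : graph) : nat := #|edges G|.

Definition nloops (G : graph) : nat := #|[pred x : G | adj x x]|.

Section Induced.
Variables (G : graph) (A : {set G}).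

Definition induced_adj : rel {x : G | x \in A} :=
  fun x y => adj (val x) (val y).

Lemma induced_adj_sym : symmetric induced_adj.
Proof. by move=> x y; exact: adj_sym. Qed.

Definition induced : graph := Graph induced_adj_sym.
End Induced.

(* [y = x] is allowed, so a vertex carrying a loop is not isolated. *)
Definition isolated_vertex (G : graph) (x : G) : bool :=
  ~~ [exists y : G, adj x y].

Definition drop_isolated (G : graph) : graph :=
  induced (finset (fun x : G => ~~ isolated_vertex x)).

Definition graph_iso (G H : graph) : Prop :=
  exists2 f : G -> H, bijective f & {mono f : x y / adj x y}.

Lemma graph_iso_refl G : graph_iso G G.
Proof. by exists id => //; exists id. Qed.

Lemma graph_iso_sym G H : graph_iso G H -> graph_iso H G.
Proof.
move=> [f [g fK gK] fm]; exists g; first by exists f.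
by move=> x y; rewrite -fm !gK.
Qed.

Lemma graph_iso_trans G H K :
  graph_iso G H -> graph_iso H K -> graph_iso G K.
Proof.
move=> [f fb fm] [g gb gm]; exists (g \o f); first exact: bij_comp.
by move=> x y /=; rewrite gm fm.
Qed.

(* Unlabeled graphs are the isomorphism classes of graphs with vertex set 'I_n,
   coded by their symmetric adjacency matrices: unlike [graph] itself, this
   type of representatives is small enough to carry a [countType] structure.
   By [unlabelP] below, every graph has a class and the classes of two graphs
   agree exactly when the graphs are isomorphic. *)
Definition mxgraph : Type := {n : nat & {M : 'M[bool]_n | M^T == M}}.
HB.instance Definition _ := Countable.on mxgraph.

Section OfMatrix.
Variable M : mxgraph.

Definition mx_adj : rel 'I_(tag M) := fun i j => val (tagged M) i j.

Lemma mx_adj_sym : symmetric mx_adj.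
Proof. by move=> i j; rewrite /mx_adj -[in LHS](eqP (valP (tagged M))) mxE. Qed.

Definition graph_of_mx : graph := Graph mx_adj_sym.
End OfMatrix.

Definition mxgraph_iso : rel mxgraph :=
  fun M N => `[< graph_iso (graph_of_mx M) (graph_of_mx N) >].

Lemma mxgraph_iso_refl : reflexive mxgraph_iso.
Proof. by move=> M; apply/asboolP; exact: graph_iso_refl. Qed.

Lemma mxgraph_iso_sym : symmetric mxgraph_iso.
Proof. by move=> M N; apply/asboolP/asboolP => /graph_iso_sym. Qed.

Lemma mxgraph_iso_trans : transitive mxgraph_iso.
Proof.
move=> N M P /asboolP MN /asboolP NP; apply/asboolP.
exact: graph_iso_trans MN NP.
Qed.

Canonical mxgraph_iso_equiv :=
  EquivRel mxgraph_iso mxgraph_iso_refl mxgraph_iso_sym mxgraph_iso_trans.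

Definition ugraph : Type := {eq_quot mxgraph_iso}%qT.
HB.instance Definition _ := Choice.on ugraph.
HB.instance Definition _ := EqQuotient.on ugraph.
HB.instance Definition _ := [Countable of ugraph by <:%/].

Section ToMatrix.
Variable G : graph.

Definition adj_mx : 'M[bool]_#|G| :=
  \matrix_(i, j) adj (enum_val i) (enum_val j).

Lemma adj_mx_sym : adj_mx^T == adj_mx.
Proof. by apply/eqP/matrixP => i j; rewrite !mxE adj_sym. Qed.

Definition mx_of_graph : mxgraph :=
  existT (fun n => {M : 'M[bool]_n | M^T == M}) #|G| (exist _ adj_mx adj_mx_sym).

Lemma mx_of_graph_iso : graph_iso (graph_of_mx mx_of_graph) G.
Proof.
exists (@enum_val G (mem G)) => [|i j]; first exact: enum_val_bij.
by rewrite /= /mx_adj /= mxE.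
Qed.

Definition unlabel : ugraph := \pi_(ugraph)%qT mx_of_graph.
End ToMatrix.

Lemma unlabelP G H : unlabel G = unlabel H <-> graph_iso G H.
Proof.
have GG := mx_of_graph_iso G; have HH := mx_of_graph_iso H.
split=> [/eqmodP /asboolP GH|GH].
  exact: graph_iso_trans (graph_iso_sym GG) (graph_iso_trans GH HH).
apply/eqmodP/asboolP.
exact: graph_iso_trans GG (graph_iso_trans GH (graph_iso_sym HH)).
Qed.

HB.instance Definition _ := isPointed.Build ugraph
  (unlabel (@Graph void (fun _ _ => false) (fun _ _ => erefl))).

HB.instance Definition _ := hasNbhs.Build ugraph principal_filter.
HB.instance Definition _ := Discrete_ofNbhs.Build ugraph erefl.

(* every set is measurable: this is the Borel sigma-algebra of the discrete
   topology *)
HB.instance Definition _ := @isMeasurable.Build default_measure_display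
  ugraph discrete_measurable discrete_measurable0 discrete_measurableC
  discrete_measurableU.

Section Sampling.
Variables (R : realType) (G : graph) (p : {nonneg R}).

Definition keep_prob : R := Num.min p%:num 1.

Definition keep_weight (A : {set G}) : R :=
  \prod_(v : G) (if v \in A then keep_prob else 1 - keep_prob).

Definition sample_of (A : {set G}) : ugraph :=
  unlabel (drop_isolated (induced A)).

Local Open Scope ereal_scope.

(* the law of [sample_of A] for the random set [A] of kept vertices *)
Definition smpl (U : set ugraph) : \bar R :=
  \sum_(A : {set G}) (keep_weight A)%:E * \d_(sample_of A) U.

Lemma keep_weight_ge0 A : (0 <= keep_weight A)%R.
Proof.
apply: prodr_ge0 => v _; case: ifP => _; rewrite /keep_prob.
  by rewrite le_min ler01 andbT.
by rewrite subr_ge0 ge_min lexx orbT.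
Qed.

Lemma sum_keep_weight : (\sum_(A : {set G}) keep_weight A = 1)%R.
Proof.
transitivity (\prod_(v : G) (keep_prob + (1 - keep_prob)))%R.
  by rewrite bigA_distr; apply: eq_bigl => A; rewrite inE.
by rewrite big1 // => v _; rewrite addrC subrK.
Qed.

Let smpl0 : smpl set0 = 0.
Proof. by rewrite /smpl big1 // => A _; rewrite measure0 mule0. Qed.

Let smpl_ge0 U : 0 <= smpl U.
Proof.
by apply: sume_ge0 => A _; rewrite mule_ge0 // lee_fin keep_weight_ge0.
Qed.

Let smpl_sigma_additive : semi_sigma_additive smpl.
Proof.
move=> F mF tF mUF.
rewrite [X in _ --> X](_ : _ =
    lim ((fun n => \sum_(0 <= i < n) smpl (F i)) @ \oo)).
  exact: is_cvg_ereal_nneg_natsum.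
rewrite nneseries_sum//; last first.
  by move=> A i _; rewrite mule_ge0 // lee_fin keep_weight_ge0.
apply: eq_bigr => /= A _; rewrite nneseriesZl//.
by congr (_ * _); exact: measure_semi_bigcup.
Qed.

HB.instance Definition _ := isMeasure.Build _ _ _ smpl
  smpl0 smpl_ge0 smpl_sigma_additive.

Let smpl_setT : smpl setT = 1.
Proof.
rewrite /smpl; under eq_bigr do rewrite diracT mule1.
by rewrite sumEFin sum_keep_weight.
Qed.

HB.instance Definition _ := Measure_isProbability.Build _ _ _ smpl smpl_setT.

End Sampling.

Definition smplD (R : realType) (G : graph) (s : {nonneg R}) :
    probability ugraph R :=
  smpl G (s%:num / Num.sqrt (2 * (nedges G)%:R))%:nng.

Definition weakly_converges (R : realType) (P : nat -> probability ugraph R)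
    (Q : probability ugraph R) : Prop :=
  forall f : ugraph -> R, continuous f -> bounded_fun f ->
    (\int[P j]_x (f x)%:E)%E @[j --> \oo] --> (\int[Q]_x (f x)%:E)%E.

Definition sampling_convergent (R : realType) (G : nat -> graph) : Prop :=
  forall s : {nonneg R}, exists Q : probability ugraph R,
    weakly_converges (fun j => smplD (G j) s) Q.

(* Main.v *)
(* The core of a vertex set, its non-isolated vertices, determines the sample.
   At p = s / sqrt (2 e) each of the l loops survives with probability at most p
   and each of the e edges with probability at most p ^ 2, so the core has
   expected size at most p l + 2 p ^ 2 e = O(s + s ^ 2), uniformly along the
   sequence. By Markov this makes the laws SmplD(G_j, s) tight. Moreover
   Smpl(G, p q) is Smpl(G, p) thinned at rate q, and the thinning matters only if
   it hits the core; hence the point masses of SmplD(G_j, s) are locally Lipschitz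
   in s, uniformly in j. A subsequence along which they converge for all rational
   s therefore works for all real s, and tightness turns convergence of the point
   masses into weak convergence. *)

Require Import Defs.
From mathcomp Require Import all_boot all_order all_algebra.
From mathcomp Require Import all_classical all_reals all_analysis.
From mathcomp Require Import ring lra.
Import Order.TTheory GRing.Theory Num.Theory.
Import numFieldNormedType.Exports.
Set Implicit Arguments.
Unset Strict Implicit.
Unset Printing Implicit Defensive.
Local Open Scope classical_set_scope.
Local Open Scope ring_scope.

(** * Random vertex sets with independent memberships *)

Section Bernoulli.
Variables (R : realFieldType) (T : finType).
Implicit Types (p q : R) (A B C : {set T}).

Definition bern p A : R := \prod_(v : T) (if v \in A then p else 1 - p).

Lemma bern_ge0 p A : 0 <= p <= 1 -> 0 <= bern p A.
Proof.
move=> /andP[p0 p1]; apply: prodr_ge0 => v _.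
by case: ifP => // _; rewrite subr_ge0.
Qed.

Lemma sum_set_prod (h : T -> bool -> R) :
  \sum_(A : {set T}) \prod_v h v (v \in A) = \prod_v (h v true + h v false).
Proof.
rewrite bigA_distr; apply: eq_big => [A|A _]; first by rewrite inE.
by apply: eq_bigr => v _; case: ifP.
Qed.

Lemma bern_sum1 p : \sum_(A : {set T}) bern p A = 1.
Proof.
rewrite (sum_set_prod (fun _ b => if b then p else 1 - p)) big1 // => v _.
by rewrite addrC subrK.
Qed.

Lemma bern_subset p B :
  \sum_(A : {set T} | B \subset A) bern p A = p ^+ #|B|.
Proof.
(* The condition [B \subset A] enters the product as a zero factor at each vertex of [B] outside
   [A], so the sum factors over vertices. *)
transitivity (\sum_(A : {set T}) \prod_v (if v \in A then p else
                if v \in B then 0 else 1 - p)).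
  rewrite big_mkcond; apply: eq_bigr => A _; case: ifP => [/fintype.subsetP BA|].
    apply: eq_bigr => v _; case: ifP => // vA; case: ifP => // vB.
    by rewrite BA in vA.
  move=> /negbT /fintype.subsetPn[v vB vA].
  by rewrite (bigD1 v) //= (negPf vA) vB mul0r.
rewrite (sum_set_prod (fun v b => if b then p else
                if v \in B then 0 else 1 - p)).
rewrite -prodr_const [RHS]big_mkcond /=; apply: eq_bigr => v _.
by case: ifP => _; rewrite ?addr0 // addrC subrK.
Qed.

(** A vertex that must survive two independent rounds, at rates [p] and [q], survives with
    probability [p * q]. This couples the samples at two rates. *)
Lemma bern_thin p q (f : {set T} -> R) :
  \sum_(B : {set T}) \sum_(A : {set T}) bern p B * bern q A * f (A :&: B) =
  \sum_(C : {set T}) bern (p * q) C * f C.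
Proof.
(* The indicator of [C = A :&: B] is a product of indicators over vertices; for fixed [C] the sums
   over [A] and [B] then factor. *)
have E B A : bern p B * bern q A * f (A :&: B) =
    \sum_(C : {set T}) \prod_v ((if v \in B then p else 1 - p) *
      (if v \in A then q else 1 - q) * (((v \in A) && (v \in B)) == (v \in C))%:R)
      * f C.
  rewrite (bigD1 (A :&: B)) //= [X in _ + X]big1 ?addr0.
    congr (_ * _); rewrite -big_split /=; apply: eq_bigr => v _.
    by rewrite inE eqxx mulr1.
  move=> C; rewrite eq_sym => CAB.
  suff /existsP[v vC] : [exists v, ((v \in A) && (v \in B)) != (v \in C)].
    by rewrite (bigD1 v) //= (negPf vC) mulr0 !mul0r.
  apply: contraR CAB => /existsPn H; apply/eqP/setP => v.
  by have /negPn/eqP := H v; rewrite inE.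
under eq_bigr do under eq_bigr do rewrite E.
under eq_bigr do rewrite exchange_big.
rewrite exchange_big; apply: eq_bigr => C _ /=.
under eq_bigr do rewrite -mulr_suml.
rewrite -mulr_suml; congr (_ * _).
under eq_bigr => B _ do rewrite (sum_set_prod (fun v b =>
   (if v \in B then p else 1 - p) *
      (if b then q else 1 - q) * ((b && (v \in B)) == (v \in C))%:R)).
rewrite (sum_set_prod (fun v c =>
   (if c then p else 1 - p) *
      (if true then q else 1 - q) * ((true && c) == (v \in C))%:R +
   (if c then p else 1 - p) *
      (if false then q else 1 - q) * ((false && c) == (v \in C))%:R)) /=.
by apply: eq_bigr => v _; case: (v \in C) => /=; ring.
Qed.

End Bernoulli.

(** * Non-isolated vertices of an induced subgraph *)

Section Core.
Variable G : graph.
Implicit Types A B : {set G}.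

(** A subset of [G] rather than a nested subtype, so that cores of different vertex sets can be
    compared. The witness [y] may be [x] itself, so a loop suffices. *)
Definition core A : {set G} :=
  finset (fun x : G => (x \in A) && [exists y in A, adj x y]).

Lemma core_sub A : core A \subset A.
Proof. by apply/fintype.subsetP => x; rewrite inE => /andP[]. Qed.

Lemma core_mono A B : A \subset B -> core A \subset core B.
Proof.
move=> /fintype.subsetP AB; apply/fintype.subsetP => x.
rewrite !inE => /andP[/AB -> /exists_inP[y yA xy]] /=.
by apply/exists_inP; exists y => //; exact: AB.
Qed.

(** By symmetry of adjacency, a neighbour in [A] of a core vertex is itself in the core. *)
Lemma core_idem A : core (core A) = core A.
Proof.
apply/setP => x; rewrite [LHS]inE andb_idr // => xA.
move: (xA); rewrite inE => /andP[xinA /exists_inP[y yA xy]].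
apply/exists_inP; exists y => //; rewrite inE yA /=.
by apply/exists_inP; exists x => //; rewrite adj_sym.
Qed.

(** [A :&: B] lies between [core B] and [B], which have the same core by [core_idem]. *)
Lemma coreI_id A B : core B \subset A -> core (A :&: B) = core B.
Proof.
move=> BA; apply/eqP; rewrite finset.eqEsubset core_mono ?finset.subsetIr //=.
by rewrite -{1}core_idem core_mono // finset.subsetI BA core_sub.
Qed.

Lemma drop_isolated_core A :
  graph_iso (drop_isolated (Defs.induced A)) (Defs.induced (core A)).
Proof.
have inA (x : drop_isolated (Defs.induced A)) : val (val x) \in core A.
  rewrite inE (valP (val x)) /=; have := valP x; rewrite inE negbK.
  by move=> /existsP[y xy]; apply/exists_inP; exists (val y) => //; exact: valP.
have incore (x : Defs.induced (core A)) : val x \in A.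
  exact: (fintype.subsetP (core_sub A)) (valP x).
have ninA (x : Defs.induced (core A)) : (exist _ (val x) (incore x) : Defs.induced A) \in
    finset (fun x : Defs.induced A => ~~ isolated_vertex x).
  rewrite inE negbK; have := valP x; rewrite inE => /andP[_ /exists_inP[y yA xy]].
  by apply/existsP; exists (exist _ y yA).
exists (fun x => exist _ (val (val x)) (inA x)) => //.
exists (fun x => exist _ (exist _ (val x) (incore x)) (ninA x)).
  by move=> x; do 2 apply: val_inj.
by move=> x; apply: val_inj.
Qed.

Lemma sample_of_core A : sample_of A = unlabel (Defs.induced (core A)).
Proof. by apply/unlabelP; exact: drop_isolated_core. Qed.

Lemma sample_of_setI A B : core B \subset A -> sample_of (A :&: B) = sample_of B.
Proof. by move=> BA; rewrite !sample_of_core coreI_id. Qed.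

(** Group the ordered pairs by their underlying edge: each edge has at most two orientations. *)
Lemma card_adj_pairs :
  (#|[pred z : G * G | (z.1 != z.2) && adj z.1 z.2]| <= 2 * nedges G)%N.
Proof.
rewrite -sum1_card (partition_big (fun z : G * G => [set z.1; z.2]%SET)
  (mem (edges G))) /=; last first.
  move=> [x y] /= /andP[xy axy]; rewrite inE.
  by apply/existsP; exists x; apply/existsP; exists y; rewrite xy axy eqxx.
rewrite mulnC -sum_nat_const; apply: leq_sum => E; rewrite inE.
move=> /existsP[x /existsP[y /and3P[xy axy /eqP ->]]].
rewrite sum1_card.
apply: (@leq_trans #|[set (x, y); (y, x)]%SET|); last by rewrite cards2; case: eqP.
apply: subset_leq_card; apply/fintype.subsetP => -[a b].
rewrite !inE /= => /andP[/andP[ab _] /eqP abxy].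
have : a \in [set x; y]%SET by rewrite -abxy !inE eqxx.
have : b \in [set x; y]%SET by rewrite -abxy !inE eqxx orbT.
rewrite !inE => /orP[]/eqP bE /orP[]/eqP aE; rewrite bE aE ?eqxx ?orbT //.
  by rewrite aE bE eqxx in ab.
by rewrite aE bE eqxx in ab.
Qed.

Variable R : realFieldType.

(** At rate [p], the expected number of kept loops plus the expected number of endpoints of kept
    edges, counted with multiplicity. *)
Definition core_bound (p : R) : R := p * (nloops G)%:R + 2 * p ^+ 2 * (nedges G)%:R.

(* Each non-isolated vertex of the sample carries a sampled loop or edge. *)
Lemma bern_card_core (p : R) : 0 <= p <= 1 ->
  \sum_(A : {set G}) bern p A * #|core A|%:R <= core_bound p.
Proof.
move=> p01; have /andP[p0 p1] := p01.
have leA A : (#|core A| <= \sum_(x : G | adj x x) (x \in A) +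
    \sum_(z : G * G | (z.1 != z.2) && adj z.1 z.2)
      ((z.1 \in A) && (z.2 \in A)))%N.
  rewrite -sum1_card big_mkcond [X in (_ <= X + _)%N]big_mkcond.
  (* Grouping the pairs by first coordinate lets each core vertex be charged to its own loop or to a
     pair starting at it. *)
  rewrite -(pair_big_dep xpredT (fun x y => (x != y) && adj x y)
             (fun x y => ((x \in A) && (y \in A)) : nat)) /=.
  rewrite -big_split /=; apply: leq_sum => x _.
  case: ifP => //; rewrite inE => /andP[xA /exists_inP[y yA xy]].
  have [xx|xx] := boolP (adj x x); first by rewrite xA.
  have nxy : x != y by apply: contraNneq xx => {2}->.
  by rewrite (bigD1 y) ?nxy ?xy //= xA yA.
apply: le_trans (_ : \sum_(A : {set G}) bern p A *
   (\sum_(x : G | adj x x) (x \in A)%:R +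
    \sum_(z : G * G | (z.1 != z.2) && adj z.1 z.2)
      ((z.1 \in A) && (z.2 \in A))%:R) <= _).
  apply: ler_sum => A _; rewrite ler_wpM2l ?bern_ge0 //.
  by rewrite -!natr_sum -natrD ler_nat.
under eq_bigr do rewrite mulrDr !mulr_sumr.
rewrite big_split /= exchange_big [X in _ + X]exchange_big /=.
have sub B : \sum_(A : {set G}) bern p A * (B \subset A)%:R = p ^+ #|B|.
  rewrite -bern_subset [RHS]big_mkcond; apply: eq_bigr => A _.
  by case: ifP; rewrite ?mulr1 ?mulr0.
apply: lerD.
  under eq_bigr => x _ do under eq_bigr => A _ do rewrite -finset.sub1set.
  under eq_bigr do rewrite sub cards1 expr1.
  by rewrite sumr_const mulr_natr.
under eq_bigr => x _ do under eq_bigr => A _ do rewrite -!finset.sub1set -finset.subUset.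
apply: le_trans (_ : \sum_(z : G * G | (z.1 != z.2) && adj z.1 z.2) p ^+ 2 <= _).
  by apply: ler_sum => -[x y] /= /andP[xy _]; rewrite sub cards2 xy.
rewrite sumr_const -[leLHS]mulr_natr [leRHS]mulrAC [leRHS]mulrC ler_wpM2l ?exprn_ge0 //.
by rewrite -natrM ler_nat card_adj_pairs.
Qed.

(* Thinning [B] by [A] changes the sample only if it removes a vertex of the
   core of [B]. *)
Lemma bern_sample_lipschitz (p q : R) (f : ugraph -> R) :
  0 <= p <= 1 -> 0 <= q <= 1 -> (forall U, 0 <= f U <= 1) ->
  `|\sum_(A : {set G}) bern (p * q) A * f (sample_of A) -
    \sum_(A : {set G}) bern p A * f (sample_of A)| <= (1 - q) * core_bound p.
Proof.
move=> p01 q01 f01.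
rewrite -(bern_thin p q (fun A => f (sample_of A))).
(* A dummy average over [A], of total weight 1, puts both expectations on the same pairs
   [(B, A)]. *)
have -> : \sum_(A : {set G}) bern p A * f (sample_of A) =
    \sum_(B : {set G}) \sum_(A : {set G}) bern p B * bern q A * f (sample_of B).
  by apply: eq_bigr => B _; rewrite -mulr_suml -mulr_sumr bern_sum1 mulr1.
rewrite -sumrB.
apply: le_trans (_ : _ <= (1 - q) * \sum_(A : {set G}) bern p A * #|core A|%:R) _;
  last by rewrite ler_wpM2l ?bern_card_core // subr_ge0; case/andP: q01.
rewrite mulr_sumr; apply: le_trans (ler_norm_sum _ _ _) (ler_sum _ _) => B _.
rewrite -sumrB mulrCA.
under eq_bigr do rewrite -mulrBr -mulrA.
rewrite -mulr_sumr normrM ger0_norm ?bern_ge0 // ler_wpM2l ?bern_ge0 //.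
(* Union bound: the difference is 0 if no core vertex is removed and at most 1 otherwise, hence at
   most the number of removed core vertices. *)
apply: le_trans (_ : \sum_(A : {set G}) bern q A *
    \sum_(v in core B) (1 - (v \in A)%:R) <= _).
  apply: le_trans (ler_norm_sum _ _ _) (ler_sum _ _) => A _.
  rewrite normrM ger0_norm ?bern_ge0 // ler_wpM2l ?bern_ge0 //.
  have ge0 (v : G) : 0 <= 1 - (v \in A)%:R :> R.
    by rewrite subr_ge0 lern1 leq_b1.
  have [BA|/fintype.subsetPn[v vB vA]] := boolP (core B \subset A).
    by rewrite sample_of_setI // subrr normr0 sumr_ge0.
  rewrite (bigD1 v) //= (negPf vA) subr0 ler_wpDr ?sumr_ge0 //.
  have := f01 (sample_of (A :&: B)); have := f01 (sample_of B).
  by rewrite ler_norml; lra.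
under eq_bigr do rewrite mulr_sumr.
rewrite exchange_big /=.
under eq_bigr => v _.
  under eq_bigr => A _ do rewrite mulrBr mulr1 -finset.sub1set.
  rewrite sumrB bern_sum1.
  have -> : \sum_(A : {set G}) bern q A * ([set v]%SET \subset A)%:R = q.
    rewrite -[RHS]expr1 -(cards1 v) -bern_subset [RHS]big_mkcond.
    by apply: eq_bigr => A _; case: ifP; rewrite ?mulr1 ?mulr0.
  over.
by rewrite sumr_const mulr_natr.
Qed.

End Core.

(** * Convergent subsequences of real sequences *)

(** Compactness of the unit interval gives a cluster point of the image filter. For an ultrafilter
    it is a limit: otherwise the complement of a ball around it would be a member and would have to
    meet that ball. *)
Lemma ultra_seq_limit (R : realType) (F : set_system nat) (u : nat -> R) :
  UltraFilter F -> (forall n, 0 <= u n <= 1) ->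
  exists l, forall e, 0 < e -> F [set n | `|u n - l| < e].
Proof.
move=> UF u01; have PF := @ultra_proper _ _ UF.
have uF : (u @ F) `[0, 1]%classic.
  by rewrite /fmap /=; apply: filterE => n /=; rewrite in_itv /= u01.
have [l [_ lF]] := @segment_compact R 0 1 (u @ F) (fmap_proper_filter u PF) uF.
exists l => e e0.
have [//|nF] := in_ultra_setVsetC [set n | `|u n - l| < e] UF.
have uC : (u @ F) [set t | ~ `|t - l| < e] by [].
have [t []] := lF _ _ uC (nbhsx_ballx l e e0).
by rewrite -ball_normE /= distrC.
Qed.

(* Limits along one ultrafilter on [nat] are limits of a common subsequence:
   a finite intersection of its members is never empty. *)
Lemma subsequence_pointwise_cvg (R : realType) (I : countType)
    (x : nat -> I -> R) : (forall n i, 0 <= x n i <= 1) ->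
  exists2 phi : nat -> nat, {homo phi : m n / (m < n)%N} &
    forall i, cvgn (fun n => x (phi n) i).
Proof.
move=> x01; have [F [UF oF]] := ultraFilterLemma eventually_filter.
have PF := @ultra_proper _ _ UF.
have [y yP] := choice (fun i => ultra_seq_limit UF (x01 ^~ i)).
(* Only finitely many indices have code below [k], so finitely many members of [F] are
   intersected. *)
have Fk k (e : R) : 0 < e ->
    F [set n | forall i, (pickle i < k)%N -> `|x n i - y i| < e].
  move=> e0; elim: k => [|k IH]; first exact: filterE.
  have [[j jk]|nk] := pselect (exists j : I, pickle j = k); last first.
    apply: filterS IH => n nP i; rewrite ltnS leq_eqVlt => /orP[/eqP ik|].
      by case: nk; exists i.
    exact: nP.
  apply: filterS2 (yP j e e0) IH => n nj nP i; rewrite ltnS leq_eqVlt -jk.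
  by move=> /orP[/eqP/(pcan_inj pickleK) ->//|]; rewrite jk; exact: nP.
have next (mk : nat * nat) : exists n, (mk.1 < n)%N /\
    forall i : I, (pickle i < mk.2)%N -> `|x n i - y i| < mk.2.+1%:R^-1.
  case: mk => m k /=; have k0 : 0 < k.+1%:R^-1 :> R by rewrite invr_gt0 ltr0n.
  have Fm : F [set n | (m < n)%N] by apply: oF; exact: nbhs_infty_gt.
  by have [n []] := filter_ex (filterI Fm (Fk k _ k0)); exists n.
have [g gP] := choice next.
(* Stage [n] controls the indices of code below [n] to within [1 / (n + 1)] and, for positive [n],
   goes beyond [phi (n - 1)]. *)
pose phi := fix phi n := if n is n'.+1 then g (phi n', n) else g (0, 0)%N.
exists phi.
  apply: homo_ltn; first exact: ltn_trans.
  by move=> n /=; have [] := gP (phi n, n.+1).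
move=> i; apply/cvg_ex; exists (y i); apply/cvgrPdistC_lt => e e0.
near=> n.
have [m nm] : exists m, n = m.+1.
  by exists n.-1; rewrite prednK //; near: n; exact: nbhs_infty_gt.
have [_ /(_ i)] := gP (phi m, m.+1).
rewrite nm /= -nm => H; apply: lt_trans (H _) _.
  by near: n; exact: nbhs_infty_gt.
near: n; exact: near_infty_natSinv_lt (PosNum e0).
Unshelve. all: by end_near.
Qed.

(** Being eventually within every [e] of some limit makes [u] Cauchy. This carries convergence from
    rational to real sampling parameters. *)
Lemma cvgn_approx (R : realType) (u : nat -> R) :
  (forall e, 0 < e -> exists2 v : nat -> R, cvgn v &
     \forall n \near \oo, `|u n - v n| <= e) -> cvgn u.
Proof.
move=> uv; apply/cauchy_cvgP/cauchy_exP => e e0.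
have e2 : 0 < e / 2 by rewrite divr_gt0.
have [v vc vu] := uv _ e2.
exists (limn v); rewrite /= near_simpl; near=> n.
rewrite -ball_normE /= (splitr e).
rewrite -[_ - _](subrKA (v n)) (le_lt_trans (ler_normD _ _)) // ltr_leD //.
  by near: n; move/cvgrPdist_lt: vc; apply.
by rewrite distrC; near: n.
Unshelve. all: by end_near.
Qed.

Lemma set_seq_cons (T : eqType) (x : T) (s : seq T) :
  [set` x :: s] = [set x] `|` [set` s].
Proof.
by apply/seteqP; split=> y /=; rewrite inE => /predU1P.
Qed.

(** * Weak convergence on the countable space of unlabeled graphs *)

Section DiscreteProkhorov.
Variable R : realType.
Implicit Types (P Q : probability ugraph R) (U V : ugraph) (s : seq ugraph).

Definition pmf P U : R := fine (P [set U]).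

Lemma bounded_integrable P (A : set ugraph) (f : ugraph -> R) (M : R) :
  (forall U, `|f U| <= M) -> P.-integrable A (EFin \o f).
Proof.
move=> fM; apply: measurable_bounded_integrable => //.
  by rewrite -ge0_fin_numE // fin_num_measure.
apply: filterS (nbhs_pinfty_ge (num_real M)) => K MK U _.
exact: le_trans (fM U) MK.
Qed.

Lemma Rintegral_seq P (f : ugraph -> R) (M : R) s : (forall U, `|f U| <= M) ->
  uniq s -> \int[P]_(x in [set` s]) f x = \sum_(U <- s) f U * pmf P U.
Proof.
move=> fM; elim: s => [_|U s IH /= /andP[Us us]].
  by rewrite set_nil Rintegral_set0 big_nil.
rewrite set_seq_cons big_cons Rintegral_setU //; last 2 first.
- exact: bounded_integrable fM.
- apply/disj_setPS => V [/= -> Us']; by rewrite Us' in Us.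
rewrite IH //; congr (_ + _).
rewrite -[RHS](Rintegral_cst P (D := [set U])) //.
by apply: eq_Rintegral => V; rewrite inE => ->.
Qed.

Lemma fine_prob_seq P s : uniq s -> fine (P [set` s]) = \sum_(U <- s) pmf P U.
Proof.
move=> us; rewrite -[LHS]mul1r -(Rintegral_cst P (D := [set` s])) //.
rewrite (@Rintegral_seq _ _ 1) // => [|U]; last by rewrite normr1.
by apply: eq_bigr => U _; rewrite mul1r.
Qed.

Lemma fine_prob_setC P s : uniq s ->
  fine (P (~` [set` s])) = 1 - \sum_(U <- s) pmf P U.
Proof.
move=> us; rewrite probability_setC // fineB ?fin_num_measure //=.
by rewrite fine_prob_seq.
Qed.

Lemma pmf_ge0 P U : 0 <= pmf P U.
Proof. exact: fine_ge0. Qed.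

Lemma sum_pmf_le1 P s : uniq s -> \sum_(U <- s) pmf P U <= 1.
Proof. by move=> us; rewrite -subr_ge0 -fine_prob_setC // fine_ge0. Qed.

(** On [s] the integral equals the sum, so the error is the integral over the complement, whose mass
    is [1 - \sum_(U <- s) pmf P U]. *)
Lemma integral_tail P (f : ugraph -> R) (M : R) s : (forall U, `|f U| <= M) ->
  uniq s -> `|\int[P]_x f x - \sum_(U <- s) f U * pmf P U| <=
    M * (1 - \sum_(U <- s) pmf P U).
Proof.
move=> fM us; rewrite -(setUv [set` s]) Rintegral_setU //; last 2 first.
- exact: bounded_integrable fM.
- by apply/disj_setPCl.
rewrite (Rintegral_seq _ fM) // addrAC subrr add0r.
have fi A : P.-integrable A (EFin \o f) by exact: bounded_integrable fM.
apply: le_trans (le_normr_Rintegral _ (fi _)) _ => //.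
rewrite -fine_prob_setC // -(Rintegral_cst P (D := ~` [set` s])) //.
apply: le_Rintegral => //; apply: (@bounded_integrable _ _ _ M) => U /=.
  by rewrite normr_id.
by rewrite ger0_norm // (le_trans _ (fM U)).
Qed.

Section MassFunction.
Variables (q : ugraph -> R) (q_ge0 : forall U, 0 <= q U).

(** The weights [q] are re-indexed by codes so that the measure is a series of Dirac masses over
    [nat]. Numbers that code no graph get weight 0, so the default [point] in [atom] receives no
    mass from them. *)
Let mass (n : nat) : R := oapp q 0 (pickle_inv n : option ugraph).

Let mass_ge0 n : 0 <= mass n.
Proof. by rewrite /mass; case: pickle_inv => //=. Qed.

Let atom (n : nat) : {measure set ugraph -> \bar R} :=
  mscale (NngNum (mass_ge0 n))
    (dirac (odflt point (pickle_inv n : option ugraph))).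

Definition mass_measure : {measure set ugraph -> \bar R} := mseries atom 0.

Lemma mass_measure1 U : mass_measure [set U] = (q U)%:E.
Proof.
rewrite /mass_measure /= /mseries (nneseriesD1 (n := pickle U)) //.
rewrite eseries0 ?addr0.
  by rewrite /= /mscale /= /mass pickleK_inv /= diracE in_set1 eqxx mule1.
move=> n _ /= nU; rewrite /mscale /= /mass.
case E : (pickle_inv n) => [V|] /=; last by rewrite mul0e.
have /= Vn := pickle_invK (T := ugraph) n; rewrite E /= in Vn.
rewrite diracE in_set1 (_ : V == U = false) ?mule0 //.
by apply: contraNF nU => /eqP <-; rewrite Vn.
Qed.

Lemma mass_measureT_le1 : (forall s, uniq s -> \sum_(U <- s) q U <= 1) ->
  (mass_measure setT <= 1)%E.
Proof.
move=> q1; rewrite /mass_measure /= /mseries.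
apply: lime_le; first exact: is_cvg_nneseries.
apply: nearW => n.
rewrite (eq_bigr (fun i => (mass i)%:E)) => [|i _]; last first.
  by rewrite /= /mscale /= diracE in_setT mule1.
rewrite sumEFin lee_fin.
(* A partial sum of the series is the sum of [q] over the distinct graphs of code below [n]. *)
have us := pmap_uniq (@pickle_invK ugraph) (iota_uniq 0 n).
have := q1 _ us; rewrite big_pmap /index_iota subn0; exact.
Qed.

End MassFunction.

(** Finite sums of masses pass to the limit, so the limit masses total at most 1; tightness prevents
    mass from escaping, so they total exactly 1. Integrals of bounded functions are then compared on
    a finite list, up to small tails. *)
Lemma discrete_prokhorov (P : nat -> probability ugraph R) :
  (forall U, cvgn (fun j => pmf (P j) U)) ->
  (forall e, 0 < e -> exists2 s, uniq s &
    \forall j \near \oo, fine (P j (~` [set` s])) <= e) ->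
  exists Q, weakly_converges P Q.
Proof.
move=> Pcvg tight.
pose q U := limn (fun j => pmf (P j) U).
have qP U : pmf (P j) U @[j --> \oo] --> q U by exact: Pcvg.
have q0 U : 0 <= q U.
  by apply: limr_ge; [exact: Pcvg|apply: nearW => j; exact: pmf_ge0].
have sumP (f : ugraph -> R) s :
    \sum_(U <- s) f U * pmf (P j) U @[j --> \oo] --> \sum_(U <- s) f U * q U.
  apply: cvg_big => [|U _]; first exact: add_continuous.
  by apply: cvgM; [exact: cvg_cst|exact: qP].
have sum1P s :
    \sum_(U <- s) pmf (P j) U @[j --> \oo] --> \sum_(U <- s) q U.
  by apply: cvg_big => [|U _]; [exact: add_continuous|exact: qP].
have qle1 s : uniq s -> \sum_(U <- s) q U <= 1.
  move=> us; rewrite -(cvg_lim _ (sum1P s)) //.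
  apply: limr_le; first by apply/cvg_ex; exists (\sum_(U <- s) q U).
  by apply: nearW => j; exact: sum_pmf_le1.
have qtight e : 0 < e -> exists2 s, uniq s &
    (\forall j \near \oo, 1 - \sum_(U <- s) pmf (P j) U <= e) /\
    1 - \sum_(U <- s) q U <= e.
  move=> e0; have [s us sP] := tight e e0; exists s => //.
  have {}sP : \forall j \near \oo, 1 - \sum_(U <- s) pmf (P j) U <= e.
    by apply: filterS sP => j; rewrite fine_prob_setC.
  split => //.
  have cv : 1 - \sum_(U <- s) pmf (P j) U @[j --> \oo] -->
      1 - \sum_(U <- s) q U by apply: cvgB; [exact: cvg_cst|exact: sum1P].
  rewrite -(cvg_lim _ cv) //; apply: limr_le sP.
  by apply/cvg_ex; exists (1 - \sum_(U <- s) q U).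
pose mu := mass_measure q0.
have mu_set1 U : mu [set U] = (q U)%:E := mass_measure1 q0 U.
have mu_seq s : uniq s -> mu [set` s] = (\sum_(U <- s) q U)%:E.
  elim: s => [_|U s IH /= /andP[Us us]]; first by rewrite set_nil measure0 big_nil.
  rewrite set_seq_cons measureU //; last first.
    by apply/seteqP; split => // V [/= -> Us']; rewrite Us' in Us.
  by rewrite big_cons EFinD; congr (_ + _)%E; [exact: mu_set1|exact: IH].
have mu1 : mu setT = 1%E.
  apply/eqP; rewrite eq_le mass_measureT_le1 //=.
  apply/lee_addgt0Pr => e e0; have [s us [_ sq]] := qtight e e0.
  apply: (@le_trans _ _ (mu [set` s] + e%:E)%E); last first.
    by rewrite leeD2r // le_measure ?inE.
  by rewrite mu_seq // -EFinD lee_fin -lerBlDl.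
(* As [mu setT = 1], normalizing leaves the values of [mu] unchanged and packages it as a
   probability. *)
pose Q : probability ugraph R := mnormalize mu (dirac point).
have QE A : Q A = mu A by rewrite /= /mnormalize mu1 onee_eq0 /= invr1 mule1.
have Qq U : pmf Q U = q U by rewrite /pmf QE mu_set1.
exists Q => f _ /pinfty_ex_gt0[M M_gt0 fM0].
have fM U : `|f U| <= M by exact: fM0.
have intE P' : (\int[P']_x (f x)%:E)%E = (\int[P']_x f x)%:E.
  by rewrite /Rintegral fineK // integrable_fin_num //; exact: bounded_integrable fM.
rewrite intE; under eq_fun do rewrite intE.
apply: cvg_EFin; first exact: nearW.
apply/cvgrPdist_le => e e0.
(* Each of the two tails then costs at most [e / 4], leaving [e / 2] for the finite sums. *)
pose d := e / 4 / M.
have d0 : 0 < d by rewrite !divr_gt0.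
have Md : M * d = e / 4 by rewrite /d mulrC divfK // gt_eqF.
have [s us [sP sq]] := qtight d d0.
near=> j.
have tQ := integral_tail Q fM us; have tP := integral_tail (P j) fM us.
have sumQ : \sum_(U <- s) pmf Q U = \sum_(U <- s) q U by exact: eq_bigr.
have sumfQ : \sum_(U <- s) f U * pmf Q U = \sum_(U <- s) f U * q U.
  by apply: eq_bigr => U _; rewrite Qq.
rewrite sumQ sumfQ in tQ.
have MQ : M * (1 - \sum_(U <- s) q U) <= e / 4 by rewrite -Md ler_pM2l.
have MP : M * (1 - \sum_(U <- s) pmf (P j) U) <= e / 4.
  by rewrite -Md ler_pM2l //; near: j.
have sPQ : `|\sum_(U <- s) f U * q U - \sum_(U <- s) f U * pmf (P j) U| <= e / 2.
  by near: j; move/cvgrPdist_le: (sumP f s); apply; rewrite divr_gt0.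
move: (le_trans tQ MQ) (le_trans tP MP) sPQ; rewrite /= !ler_norml.
by move=> /andP[? ?] /andP[? ?] /andP[? ?]; lra.
Unshelve. all: by end_near.
Qed.

End DiscreteProkhorov.

(** * Tightness and Lipschitz bounds for the sampling laws *)

(** There are finitely many Boolean matrices of order at most [K]. Their classes form the finite
    list required for tightness. *)
Lemma ugraphs_of_bounded_order (K : nat) : exists2 s : seq ugraph, uniq s &
  forall H : graph, (#|H| <= K)%N -> unlabel H \in s.
Proof.
pose T n : finType := {M : 'M[bool]_n | M^T == M}.
exists (undup [seq \pi_(ugraph)%qT (existT (fun n => {M : 'M[bool]_n | M^T == M}) n M)
  | n <- iota 0 K.+1, M <- enum (T n)]); first exact: undup_uniq.
move=> H HK; rewrite mem_undup; apply/allpairsPdep.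
by exists #|H|, (tagged (mx_of_graph H)); rewrite mem_iota mem_enum.
Qed.

Section Sampling.
Variable R : realType.
Implicit Types (G : graph) (s t : {nonneg R}).

Lemma fine_smpl G (p : {nonneg R}) (S : set ugraph) : fine (smpl G p S) =
  \sum_(A : {set G}) bern (keep_prob p) A * (sample_of A \in S)%:R.
Proof.
rewrite /smpl; under eq_bigr do rewrite diracE -EFinM.
by rewrite sumEFin.
Qed.

Lemma keep_prob01 (p : {nonneg R}) : 0 <= keep_prob p <= 1.
Proof. by rewrite /keep_prob le_min ge0 ler01 ge_min lexx orbT. Qed.

(** Markov's inequality: a sample outside [S] has a core of at least [K.+1] vertices. *)
Lemma prob_large_sample G (p : {nonneg R}) (K : nat) (S : set ugraph) :
  (forall H : graph, (#|H| <= K)%N -> S (unlabel H)) ->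
  fine (smpl G p (~` S)) <= core_bound G (keep_prob p) / K.+1%:R.
Proof.
move=> KS; rewrite fine_smpl ler_pdivlMr ?ltr0n //.
apply: le_trans (bern_card_core G (keep_prob01 p)).
rewrite mulr_suml; apply: ler_sum => A _.
rewrite -mulrA ler_wpM2l ?bern_ge0 ?keep_prob01 // -natrM ler_nat.
have [|_] := boolP (sample_of A \in ~` S); last by rewrite mul0n.
rewrite mul1n inE /= sample_of_core; apply: contra_notT; rewrite -leqNgt => AK.
by apply: KS; rewrite card_sig.
Qed.

Section LoopBound.
Variables (G : graph) (C : R) (edge_gt0 : (0 < nedges G)%N).
Variable loop_le : (nloops G)%:R <= C * Num.sqrt (nedges G)%:R.
Variable C_ge0 : 0 <= C.

Let r : R := Num.sqrt (2 * (nedges G)%:R).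

Let r_gt0 : 0 < r.
Proof. by rewrite sqrtr_gt0 mulr_gt0 ?ltr0n. Qed.

Let r_sqr : r ^+ 2 = 2 * (nedges G)%:R.
Proof. by rewrite sqr_sqrtr // mulr_ge0 ?ler0n. Qed.

Let loop_le_r : (nloops G)%:R <= C * r.
Proof.
apply: le_trans loop_le _; rewrite ler_wpM2l // ler_wsqrtr //.
by rewrite ler_peMl ?ler0n // ler1n.
Qed.

Let smpl_prob s : R :=
  keep_prob (s%:num / Num.sqrt (2 * (nedges G)%:R))%:nng.

Let smpl_prob01 s : 0 <= smpl_prob s <= 1.
Proof. exact: keep_prob01. Qed.

Let smpl_prob_le s : smpl_prob s <= s%:num / r.
Proof. by rewrite /smpl_prob /keep_prob ge_min lexx. Qed.

Let core_boundE (p : R) : core_bound G p = p * ((nloops G)%:R + p * r ^+ 2).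
Proof. by rewrite /core_bound r_sqr; ring. Qed.

(** This bounds the cofactor of [p] in [core_boundE]. The factor [r] left here cancels against the
    [1 / r] in the bound on [p], or on a difference of two such probabilities, which makes the
    estimates uniform in [G]. *)
Let degree_le s :
  (nloops G)%:R + smpl_prob s * r ^+ 2 <= r * (C + s%:num).
Proof.
rewrite mulrDr lerD //; first by rewrite mulrC.
rewrite (le_trans (ler_wpM2r _ (smpl_prob_le s))) ?sqr_ge0 //.
by rewrite expr2 mulrA divfK ?gt_eqF // mulrC.
Qed.

Lemma core_bound_smpl s : core_bound G (smpl_prob s) <= s%:num * (C + s%:num).
Proof.
rewrite core_boundE; have /andP[p0 _] := smpl_prob01 s.
apply: le_trans (ler_wpM2l p0 (degree_le s)) _.
rewrite mulrA ler_wpM2r ?addr_ge0 //.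
by rewrite -ler_pdivlMr.
Qed.

Lemma smplD_large K s (S : set ugraph) :
  (forall H : graph, (#|H| <= K)%N -> S (unlabel H)) ->
  fine (smplD G s (~` S)) <= s%:num * (C + s%:num) / K.+1%:R.
Proof.
move=> KS; apply: le_trans (prob_large_sample _ _ KS) _.
by rewrite ler_wpM2r ?invr_ge0 ?core_bound_smpl.
Qed.

(** The sample at [s] is the sample at [t] thinned at rate [q = p / p'], and [(1 - q) * p' = p' - p]
    is at most [(t - s) / r]. *)
Lemma smplD_lipschitz s t (U : ugraph) : s%:num <= t%:num ->
  `|pmf (smplD G s) U - pmf (smplD G t) U| <=
    (t%:num - s%:num) * (C + t%:num).
Proof.
move=> st; rewrite /pmf !fine_smpl.
(* The rate [p / p'] needs [p'] positive, so [t = 0] is treated apart. *)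
have [t0|t_neq0] := eqVneq t%:num 0.
  have -> : s = t by apply/val_inj/le_anti; rewrite /= st t0 /=.
  by rewrite !subrr normr0 mul0r.
have t_gt0 : 0 < t%:num by rewrite lt_neqAle eq_sym t_neq0 /=.
rewrite -/(smpl_prob s) -/(smpl_prob t).
set p := smpl_prob s; set p' := smpl_prob t.
have p01 : 0 <= p <= 1 := smpl_prob01 _.
have p'01 : 0 <= p' <= 1 := smpl_prob01 _.
have p'_gt0 : 0 < p' by rewrite lt_min ltr01 andbT divr_gt0.
have str : s%:num / r <= t%:num / r by rewrite ler_pM2r ?invr_gt0.
have pp' : p <= p' by rewrite le_min !ge_min str lexx orbT.
(* Truncation at 1 is 1-Lipschitz. *)
have dp : p' - p <= (t%:num - s%:num) / r.
  have min1 (x y : R) : x <= y -> Num.min y 1 - Num.min x 1 <= y - x.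
    by move=> xy; have [y1|y1] := leP y 1; have [x1|x1] := leP x 1; lra.
  by rewrite mulrBl; exact: min1.
have q01 : 0 <= p / p' <= 1.
  have /andP[p0 _] := p01; by rewrite ler_pdivrMr // mul1r pp' divr_ge0 // ltW.
pose f V : R := (V \in [set U])%:R.
have f01 V : 0 <= f V <= 1 by rewrite ler0n lern1 leq_b1.
have := bern_sample_lipschitz G p'01 q01 f01.
rewrite mulrCA divff ?gt_eqF // mulr1 => /le_trans; apply.
rewrite core_boundE mulrA mulrBl mul1r divfK ?gt_eqF //.
apply: le_trans (ler_wpM2l _ (degree_le t)) _; first by rewrite subr_ge0.
by rewrite mulrA ler_wpM2r ?addr_ge0 // -ler_pdivlMr.
Qed.

End LoopBound.

End Sampling.

(** * Diagonal extraction at rational parameters and passage to real ones *)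

Theorem theorem3p12 (R : realType) (G : nat -> graph)
    (edges_ge1 : forall j, (1 <= nedges (G j))%N)
    (loops_bigO : (fun j => (nloops (G j))%:R : R) =O_\oo
                  (fun j => Num.sqrt ((nedges (G j))%:R : R))) :
  exists2 phi : nat -> nat,
    {homo phi : i j / (i < j)%N} & sampling_convergent R (G \o phi).
Proof.
have [C C_gt0 loopC] := (eqO_exP _ _ _).1 loops_bigO.
have C_ge0 := ltW C_gt0.
(* The absolute value makes every rational a valid parameter, so the pairs in [rat * ugraph] form a
   countable index type for the extraction. *)
pose rs (c : rat) : {nonneg R} := NngNum (normr_ge0 (ratr c : R)).
have pmf01 n (i : rat * ugraph) : 0 <= pmf (smplD (G n) (rs i.1)) i.2 <= 1.
  rewrite pmf_ge0 /=; have := @sum_pmf_le1 _ (smplD (G n) (rs i.1)) [:: i.2] isT.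
  by rewrite big_seq1.
have [phi phi_homo phi_cvg] := subsequence_pointwise_cvg pmf01.
exists phi => // s.
(* The loop bound holds only from some index on; it passes to the subsequence because [phi j] is at
   least [j]. *)
have {}loopC : \forall j \near \oo,
    (nloops (G (phi j)))%:R <= C * Num.sqrt (nedges (G (phi j)))%:R :> R.
  have phi_ge j : (j <= phi j)%N.
    by elim: j => // j IH; apply: leq_ltn_trans IH (phi_homo _ _ (ltnSn j)).
  have [N _ NP] := loopC; exists N => // j /= Nj.
  have := NP _ (leq_trans Nj (phi_ge j)).
  by rewrite normr_nat ger0_norm ?sqrtr_ge0.
apply: discrete_prokhorov => [U|e e0].
  apply: cvgn_approx => e e0.
  (* For rational [c] between [s] and [s + d], with [d] at most 1, [D] bounds the factor [C + c], so
     the Lipschitz error is at most [d * D], hence at most [e]. *)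
  pose D := C + s%:num + 1.
  have D0 : 0 < D by rewrite ltr_wpDl // addr_ge0.
  pose d := Num.min 1 (e / D).
  have d0 : 0 < d by rewrite lt_min ltr01 divr_gt0.
  have /rat_in_itvoo[c] : s%:num < s%:num + d by rewrite ltrDl.
  rewrite in_itv /= => /andP[sc cd].
  have cE : (rs c)%:num = ratr c by rewrite /= ger0_norm // (le_trans _ (ltW sc)).
  exists (fun j => pmf (smplD (G (phi j)) (rs c)) U); first exact: phi_cvg (c, U).
  apply: filterS loopC => j jC.
  apply: le_trans (smplD_lipschitz (edges_ge1 _) jC C_ge0 U _) _.
    by rewrite cE ltW.
  rewrite cE.
  have d1 : d <= 1 by rewrite ge_min lexx.
  have dD : d * D <= e by rewrite -ler_pdivlMr // ge_min lexx orbT.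
  apply: le_trans dD; apply: ler_pM => //; rewrite /D.
  - by rewrite subr_ge0 ltW.
  - by rewrite addr_ge0 // (le_trans _ (ltW sc)).
  - by lra.
  - by lra.
pose B := s%:num * (C + s%:num).
have [K BK] : exists K : nat, B / K.+1%:R <= e.
  (* The truncation plus one exceeds [B / e], which is why the Markov denominator [K.+1]
     suffices. *)
  exists (Num.truncn (B / e)); rewrite ler_pdivrMr ?ltr0n // mulrC -ler_pdivrMr //.
  by rewrite ltW // truncnS_gt.
have [l ul lP] := ugraphs_of_bounded_order K; exists l => //.
apply: filterS loopC => j jC; apply: le_trans BK.
exact: (smplD_large (S := [set` l]) (edges_ge1 _) jC C_ge0 s lP).
Qed.
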